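(* Let $l\ge2$ and $Q_l=\mathcal{A}_1\oplus\mathcal{A}_l$, and write $M_n=M_{n,Q_l}$. If there is an $n$-element poset $P$ with $c_{Q_l}(P)=M_n-1$, then there is an $n$-element poset $Q$ with $c_{Q_l}(Q)=M_n-1$ such that (i) if $l>2$ then $Q$ is layered; (ii) if $l=2$ then $Q=Q_1\oplus Q_2$ where $|Q_1|\le5$ and $Q_2$ is layered. Furthermore, in either case $Q\cong P_r\oplus\mathcal{A}_m$ for some integer $m\ge 0$ and some permutation $r\in S_{n-m}$, where $m$ is positive unless $l=2$ and $n=5$.
   Context: $\mathcal{A}_n$ is the $n$-element antichain; $P\oplus Q$ is the ordinal sum (disjoint union, orders kept, every element of $P$ below every element of $Q$). A poset is layered if it is an ordinal sum of antichains. $c_Q(P)$ is the number of subsets of $P$ whose induced subposet is isomorphic to $Q$, and $M_{n,Q}=\max\{c_Q(P):|P|=n\}$. For a permutation $r=r_1\ldots r_k$, $P_r$ is the poset on $\{r_1,\ldots,r_k\}$ with $r_i<r_j$ iff $i<j$ and $r_i<r_j$. *)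

(* Defs.v *)
From HB Require Import structures.
From mathcomp Require Import all_boot all_order all_fingroup.

Set Implicit Arguments.
Unset Strict Implicit.
Unset Printing Implicit Defensive.

Import Order.TTheory.

Fact poset_display : Order.disp_t. Proof. exact: Order.Disp tt tt. Qed.

Section Isomorphism.
Context {d d' : Order.disp_t} (P : finPOrderType d) (Q : finPOrderType d').

(* A boolean, so that it can be used in set comprehensions. *)
Definition iso : bool :=
  [exists f : {ffun P -> Q},
     [&& injectiveb f, [forall y, exists x, f x == y]
       & [forall x, forall y, (f x <= f y)%O == (x <= y)%O]]].

Lemma isoP :
  reflect (exists2 f : P -> Q, bijective f & {mono f : x y / (x <= y)%O}) iso.
Proof.
apply: (iffP existsP) => [[f /and3P[/injectiveP finj /forallP fsurj fmono]]|].
  exists f; last by move=> x y; move/forallP/(_ x)/forallP/(_ y)/eqP: fmono.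
  apply: inj_card_bij => //; rewrite -(card_codom finj); apply: subset_leq_card.
  by apply/subsetP => y _; have /existsP[x /eqP<-] := fsurj y; apply: codom_f.
move=> [f [g fK gK] fmono]; exists [ffun x => f x]; apply/and3P; split.
- by apply/injectiveP => x y; rewrite !ffunE => /(can_inj fK).
- by apply/forallP => y; apply/existsP; exists (g y); rewrite ffunE gK.
- by apply/forallP => x; apply/forallP => y; rewrite !ffunE fmono.
Qed.

End Isomorphism.

Definition antichain (n : nat) : Type := 'I_n.

Section Antichain.
Variable n : nat.
HB.instance Definition _ := Finite.on (antichain n).

Let le (x y : antichain n) := x == y.
Let le_refl : reflexive le. Proof. by move=> x; apply: eqxx. Qed.
Let le_anti : antisymmetric le. Proof. by move=> x y /andP[/eqP]. Qed.
Let le_trans : transitive le. Proof. by move=> y x z /eqP-> /eqP->; apply: eqxx. Qed.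
HB.instance Definition _ :=
  Order.Le_isPOrder.Build poset_display (antichain n) le_refl le_anti le_trans.

Lemma antichain_leE (x y : antichain n) : (x <= y)%O = (x == y).
Proof. by []. Qed.
End Antichain.

Definition osum {d d'} (P : finPOrderType d) (Q : finPOrderType d') : Type :=
  (P + Q)%type.

Section OrdinalSum.
Context {d d' : Order.disp_t} (P : finPOrderType d) (Q : finPOrderType d').
HB.instance Definition _ := Finite.on (osum P Q).

Let le (u v : osum P Q) :=
  match u, v with
  | inl x, inl y => (x <= y)%O
  | inl _, inr _ => true
  | inr _, inl _ => false
  | inr x, inr y => (x <= y)%O
  end.
Let le_refl : reflexive le. Proof. by case=> x /=. Qed.
Let le_anti : antisymmetric le.
Proof. by case=> x [] y //= /le_anti ->. Qed.
Let le_trans : transitive le.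
Proof. by case=> y [] x [] z //=; apply: le_trans. Qed.
HB.instance Definition _ :=
  Order.Le_isPOrder.Build poset_display (osum P Q) le_refl le_anti le_trans.
Lemma osum_leE (u v : osum P Q) :
  (u <= v)%O = match u, v with
               | inl x, inl y => (x <= y)%O
               | inl _, inr _ => true
               | inr _, inl _ => false
               | inr x, inr y => (x <= y)%O
               end.
Proof. by []. Qed.
End OrdinalSum.

Fixpoint osum_antichains (s : seq nat) : finPOrderType poset_display :=
  if s is n :: s' then osum (antichain n) (osum_antichains s') else antichain 0.

Definition layered {d} (P : finPOrderType d) : Prop :=
  exists s : seq nat, iso P (osum_antichains s).

Definition subposet {d} {P : finPOrderType d} (A : {set P}) : Type :=
  {x : P | x \in A}.

Section Subposet.
Context {d : Order.disp_t} {P : finPOrderType d} (A : {set P}).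
HB.instance Definition _ := SubFinite.on (subposet A).
HB.instance Definition _ := [SubChoice_isSubPOrder of subposet A by <: with d].
Lemma subposet_leE (x y : subposet A) : (x <= y)%O = (val x <= val y)%O.
Proof. by []. Qed.
End Subposet.

Definition copies {dQ d} (Q : finPOrderType dQ) (P : finPOrderType d) : nat :=
  #|[set A : {set P} | iso (subposet A) Q]|.

(* The finite set of partial orders on 'I_n, over which the maximum M_{n,Q} is
   taken; [leq_maxcopies] and [maxcopies_attained] show that it is the maximum
   over all n-element posets. *)
Definition is_order (n : nat) (R : {set 'I_n * 'I_n}) : bool :=
  [&& [forall x, (x, x) \in R],
      [forall x, forall y, ((x, y) \in R) && ((y, x) \in R) ==> (x == y)]
    & [forall x, forall y, forall z,
         ((x, y) \in R) && ((y, z) \in R) ==> ((x, z) \in R)]].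

Definition ordering (n : nat) : finType := {R : {set 'I_n * 'I_n} | is_order R}.

Definition ordered (n : nat) (R : ordering n) : Type := 'I_n.

Section Ordered.
Variables (n : nat) (R : ordering n).
HB.instance Definition _ := Finite.on (ordered R).

Let le (x y : ordered R) := (x, y) \in val R.
Let le_refl : reflexive le.
Proof. by move=> x; have /and3P[/forallP/(_ x)] := valP R. Qed.
Let le_anti : antisymmetric le.
Proof.
move=> x y xy; have /and3P[_ /forallP/(_ x)/forallP/(_ y)/implyP h _] := valP R.
exact/eqP/h.
Qed.
Let le_trans : transitive le.
Proof.
move=> y x z xy yz; have /and3P[_ _] := valP R.
by move/forallP/(_ x)/forallP/(_ y)/forallP/(_ z)/implyP; apply; apply/andP.
Qed.
HB.instance Definition _ :=
  Order.Le_isPOrder.Build poset_display (ordered R) le_refl le_anti le_trans.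
End Ordered.

Definition maxcopies {dQ} (n : nat) (Q : finPOrderType dQ) : nat :=
  \max_(R : ordering n) copies Q (ordered R).

Section MaxCopies.
Context {dQ : Order.disp_t} (Q : finPOrderType dQ).

Lemma leq_copies_iso {d d'} (P : finPOrderType d) (P' : finPOrderType d') :
  iso P P' -> copies Q P <= copies Q P'.
Proof.
move=> /isoP[f fbij fmono]; have finj := bij_inj fbij.
rewrite /copies -(card_imset _ (imset_inj finj)); apply: subset_leq_card.
apply/subsetP => _ /imsetP[A + ->]; rewrite !inE => /isoP[g [h gK hK] gmono].
have fh y : f (val (h y)) \in f @: A by apply: imset_f; apply: (valP (h y)).
pose k (y : Q) : subposet (f @: A) := Sub (f (val (h y))) (fh y).
have kinj : injective k.
  by move=> y z /(congr1 val) /finj /val_inj /(can_inj hK).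
have kbij : bijective k.
  apply: inj_card_bij => //; rewrite card_sig card_imset // -card_sig.
  by rewrite -(@card_in_image _ _ g predT) ?max_card //; move=> ? ? _ _ /(can_inj gK).
have kmono : {mono k : x y / (x <= y)%O}.
  move=> y z; rewrite -[RHS](congr2 _ (hK y) (hK z)) gmono.
  by rewrite -[LHS]/(f (val (h y)) <= f (val (h z)))%O fmono.
have [j kK jK] := kbij; apply/isoP; exists j; first by exists k.
by move=> x y; rewrite -{2}(jK x) -{2}(jK y) kmono.
Qed.

Lemma leq_maxcopies {d} (P : finPOrderType d) : copies Q P <= maxcopies #|P| Q.
Proof.
pose e (i : 'I_#|P|) : P := enum_val i.
pose R := [set u : 'I_#|P| * 'I_#|P| | (e u.1 <= e u.2)%O].
have oR : is_order R.
  apply/and3P; split.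
  - by apply/forallP => x; rewrite inE /=.
  - apply/forallP => x; apply/forallP => y; rewrite !inE /=.
    by apply/implyP => /le_anti /enum_val_inj ->.
  - apply/forallP => x; apply/forallP => y; apply/forallP => z.
    by rewrite !inE /=; apply/implyP => /andP[]; apply: le_trans.
apply: (@leq_trans (copies Q (ordered (Sub R oR : ordering #|P|)))); last first.
  exact: (@leq_bigmax _ (fun S : ordering #|P| => copies Q (ordered S))).
apply: leq_copies_iso; apply/isoP; exists enum_rank.
  exact: enum_rank_bij.
move=> x y; rewrite -[LHS]/((enum_rank x, enum_rank y) \in R).
by rewrite inE /e /= !enum_rankK.
Qed.

Lemma maxcopies_attained n :
  exists R : ordering n, copies Q (ordered R) = maxcopies n Q.
Proof.
have od : is_order [set u : 'I_n * 'I_n | u.1 == u.2].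
  apply/and3P; split.
  - by apply/forallP => x; rewrite inE /=.
  - apply/forallP => x; apply/forallP => y; rewrite !inE /=.
    by apply/implyP => /andP[].
  - apply/forallP => x; apply/forallP => y; apply/forallP => z.
    by rewrite !inE /=; apply/implyP => /andP[/eqP-> /eqP->].
have c_gt0 : 0 < #|ordering n| by apply/card_gt0P; exists (Sub _ od).
have [R eR] :=
  @bigop.eq_bigmax (ordering n) (fun R => copies Q (ordered R)) c_gt0.
by exists R; rewrite -eR.
Qed.

End MaxCopies.

Definition perm_poset (k : nat) (r : 'S_k) : Type := 'I_k.

Section PermPoset.
Variables (k : nat) (r : 'S_k).
HB.instance Definition _ := Finite.on (perm_poset r).

(* The carrier consists of the values r_1, ..., r_k; the position of the value x
   is its preimage under r. *)
Let le : rel (perm_poset r) :=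
  fun x y : 'I_k => ((r^-1)%g x <= (r^-1)%g y) && (x <= y).
Let le_refl : reflexive le. Proof. by move=> x; rewrite /le !leqnn. Qed.
Let le_anti : antisymmetric le.
Proof.
move=> x y /andP[/andP[_ xy] /andP[_ yx]].
by apply: val_inj; apply/eqP; rewrite eqn_leq xy.
Qed.
Let le_trans : transitive le.
Proof.
move=> y x z /andP[h1 h2] /andP[h3 h4].
by rewrite /le (leq_trans h1 h3) (leq_trans h2 h4).
Qed.
HB.instance Definition _ :=
  Order.Le_isPOrder.Build poset_display (perm_poset r) le_refl le_anti le_trans.
End PermPoset.

Lemma perm_poset_ltE (k : nat) (r : 'S_k) (i j : 'I_k) :
  ((r i : perm_poset r) < (r j : perm_poset r))%O = (i < j) && (r i < r j).
Proof.
rewrite lt_neqAle -[X in _ && X]/(((r^-1)%g (r i) <= (r^-1)%g (r j)) && (r i <= r j)).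
rewrite !permK (inj_eq perm_inj) andbA [i < j]ltn_neqAle [r i < r j]ltn_neqAle.
by rewrite !(inj_eq val_inj) (inj_eq perm_inj); case: (i == j).
Qed.

(* Main.v *)
Require Import Defs.
From HB Require Import structures.
From mathcomp Require Import all_boot all_order all_fingroup.
From mathcomp Require Import zify.

Set Implicit Arguments.
Unset Strict Implicit.
Unset Printing Implicit Defensive.
Import Order.TTheory.

(* Let x, y be maximal elements of P.  Replacing y by a twin of x, or x by a twin of
   y, gives two posets whose copy numbers add up to at least 2 c(P).  Repeating this
   so that the largest class of twins grows turns an optimal poset into one of the
   form P' (+) A_m, whence M_n = M_k + k C(m, l) with k = n - m.

   If c(P) = M_n - 1, the process either keeps the value M_n - 1 until the poset has
   the form P' (+) A_m, and then c(P') is M_k or M_k - 1 and induction applies, or it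
   reaches an optimal P' (+) A_m in one step.  In the latter case P arises from
   P' (+) A_m by replacing one element of the top antichain by some y.  Making all m
   top elements twins of y yields a third poset with at most M_n copies; comparing the
   three numbers, the exchange costs at least two copies unless n = l + 1, or l = 2
   and n <= 5.  The same comparison shows that every optimal poset with M_n > 0 is of
   the form P' (+) A_m.  In the small cases an antichain, A_2 (+) A_2 and the poset of
   15342 are explicit examples. *)

(** * Copies of $Q_l$ as fans, and their number under twinning of maximal elements *)

Lemma sum_set1U (T : finType) (x : T) (F : {set T} -> nat) :
  \sum_(S : {set T}) F S = \sum_(S : {set T} | x \notin S) (F S + F (x |: S)).
Proof.
rewrite (bigID (fun S : {set T} => x \notin S)) /= big_split /=; congr addn.
rewrite (reindex_onto (fun S => x |: S) (fun S => S :\ x)) /=; last first.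
  by move=> S; rewrite negbK => xS; rewrite setD1K.
apply: eq_bigl => S; rewrite negbK setU11 /=.
apply/eqP/idP => [<-|xS]; first by rewrite !inE eqxx.
by rewrite setU1K.
Qed.

Section Fans.
Context {T : finType}.
Implicit Types (e : rel T) (u v w x y z : T) (S V W A B : {set T}) (l : nat).

Definition strict e := irreflexive e /\ transitive e.

(** A copy of $Q_l$ with bottom [z] and upper antichain [S], for a strict order [e]. Working with
    relations lets the order vary while the carrier stays fixed. *)
Definition fan e z S : bool :=
  [forall s in S, e z s] && [forall u in S, forall v in S, ~~ e u v].

Lemma fanP e z S :
  reflect ((forall s, s \in S -> e z s) /\
           (forall u v, u \in S -> v \in S -> e u v = false)) (fan e z S).
Proof.
apply: (iffP andP) => [[/forall_inP h /forall_inP h']|[h h']].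
  by split=> // u v uS vS; apply/negbTE; move/forall_inP: (h' u uS); apply.
split; first exact/forall_inP.
by apply/forall_inP => u uS; apply/forall_inP => v vS; rewrite h'.
Qed.

Definition fans e V l z := [set S : {set T} | [&& S \subset V, #|S| == l & fan e z S]].

(** Restricting to [V] counts the copies in an induced subposet without changing the carrier. *)
Definition nfans e V l := \sum_(z in V) #|fans e V l z|.

Lemma eq_fan e e' z S :
  (forall u v, u \in z |: S -> v \in S -> e u v = e' u v) -> fan e z S = fan e' z S.
Proof.
move=> h; apply/fanP/fanP => -[h1 h2]; split.
- by move=> s sS; rewrite -h ?setU11 ?h1.
- by move=> u v uS vS; rewrite -h ?h2 // setU1r.
- by move=> s sS; rewrite h ?setU11 ?h1.
- by move=> u v uS vS; rewrite h ?h2 // setU1r.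
Qed.

Lemma eq_nfans e e' V l :
  (forall u v, u \in V -> v \in V -> e u v = e' u v) -> nfans e V l = nfans e' V l.
Proof.
move=> h; apply: eq_bigr => z zV; apply: eq_card => S; rewrite !inE.
case: (boolP (S \subset V)) => //= /subsetP SV; congr andb.
apply: eq_fan => u v zuS vS; apply: h; last exact: SV.
by case/setU1P: zuS => [->|/SV].
Qed.

Definition maximal e x := [forall v, ~~ e x v].

Lemma maximalP e x : reflect (forall v, e x v = false) (maximal e x).
Proof. by apply: (iffP forallP) => h v; [exact/negbTE|rewrite h]. Qed.

Lemma fans_maximal e V l x : 0 < l -> maximal e x -> fans e V l x = set0.
Proof.
move=> l0 /maximalP mx; apply/setP => S; rewrite !inE; apply/and3P => -[_ /eqP Sl].
move=> /fanP[h _]; have /card_gt0P[s /h] : 0 < #|S| by rewrite Sl.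
by rewrite mx.
Qed.

Lemma fanU1 e z x S : maximal e x ->
  fan e z (x |: S) = fan e z S && (e z x && [forall s in S, ~~ e s x]).
Proof.
move=> /maximalP mx; apply/fanP/andP => [[h1 h2]|[/fanP[h1 h2] /andP[zx /forall_inP h3]]].
  split; first by apply/fanP; split=> [s sS|u v uS vS]; rewrite ?h1 ?h2 // !inE ?sS ?uS ?vS orbT.
  rewrite h1 ?setU11 //=; apply/forall_inP => s sS.
  by rewrite h2 ?setU11 // setU1r.
split=> [s /setU1P[->//|/h1//]|u v /setU1P[->|uS] /setU1P[->|vS]]; rewrite ?mx //.
  by apply/negbTE/h3.
exact: h2.
Qed.

(** Pulling [e] back along $y\mapsto x$ makes [y] a twin of [x], incomparable to it by
    irreflexivity; strictness is inherited. *)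
Definition clone y x e : rel T :=
  relpre (fun u => if u == y then x else u) e.

Lemma strict_pre (T' : finType) (f : T' -> T) e :
  strict e -> irreflexive (relpre f e) /\ transitive (relpre f e).
Proof. by case=> ei et; split=> [u|v u w] /=; [apply: ei|apply: et]. Qed.

Lemma clone_maximal y x e v : maximal e x -> maximal e v -> maximal (clone y x e) v.
Proof. by move=> /maximalP mx /maximalP mv; apply/maximalP => u; rewrite /clone /=; case: ifP. Qed.

(* An antichain containing both [x] and [y] contributes to the left side only below
   common lower bounds, whereas it contributes to each clone separately. *)
Lemma clone_convex e x y l : 0 < l -> x != y -> maximal e x -> maximal e y ->
  (nfans e setT l).*2 <= nfans (clone y x e) setT l + nfans (clone x y e) setT l.
Proof.
move=> l0 xy mx my; rewrite /nfans -big_split -mul2n big_distrr /=.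
apply: leq_sum => z _.
have [zx|zx] := eqVneq z x; first by rewrite zx fans_maximal // cards0.
have [zy|zy] := eqVneq z y; first by rewrite zy fans_maximal // cards0.
(* For [S] avoiding [x] and [y], the sets $S$, $S+x$, $S+y$, $S+x+y$ are counted together. [X] and
   [Y] tell whether [x] and [y] may be added to the fan. *)
have E e' : maximal e' x -> maximal e' y ->
    #|fans e' setT l z| = \sum_(S : {set T} | (x \notin S) && (y \notin S))
      (let X := e' z x && [forall s in S, ~~ e' s x] in
       let Y := e' z y && [forall s in S, ~~ e' s y] in
       fan e' z S * ((#|S| == l) + (X + Y) * (#|S|.+1 == l) + X * Y * (#|S|.+2 == l))).
  move=> mx' my'; rewrite -sum1_card big_mkcond /= (sum_set1U y).
  rewrite big_mkcond (sum_set1U x) big_mkcondr /=; apply: eq_bigr => S xS.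
  rewrite in_setU1 [y == x]eq_sym (negbTE xy) /=; case: ifP => // yS.
  rewrite !inE !subsetT !cardsU1 !inE ?[y == x]eq_sym (negbTE xy) (negbTE xS) (negbTE yS) /= !add1n !fanU1 //.
  have -> : [forall s in x |: S, ~~ e' s y] = [forall s in S, ~~ e' s y].
    apply/forall_inP/forall_inP => h s; first by move=> sS; apply/h/setU1r.
    by move/setU1P=> [->|/h//]; move/maximalP: mx' ->.
  case: (fan e' z S); rewrite ?andbF //= ?andbT.
  case: (_ && [forall s in S, ~~ e' s x]); case: (_ && [forall s in S, ~~ e' s y]);
    rewrite ?andbT ?andbF /=; do 3 case: (_ == l) => //.
rewrite !E ?clone_maximal // big_distrr -big_split; apply: leq_sum => S /andP[xS yS].
have nS u v : v \notin S -> u \in S -> (u == v) = false.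
  by move=> vS uS; apply: contraNF vS => /eqP <-.
have F u v : u \notin S -> z != u -> fan (clone u v e) z S = fan e z S.
  move=> uS zu; apply: eq_fan => a b az bS; rewrite /clone /= (nS b u) //.
  by case/setU1P: az => [->|aS]; rewrite ?(negbTE zu) ?(nS a u).
have G u v w : u \notin S -> z != u ->
    clone u v e z w && [forall s in S, ~~ clone u v e s w] =
    e z (if w == u then v else w) && [forall s in S, ~~ e s (if w == u then v else w)].
  move=> uS zu; rewrite /clone /= (negbTE zu); congr andb; apply: eq_forallb => s.
  by case: (boolP (s \in S)) => //= sS; rewrite (nS s u).
(* In one clone both indicators equal the old $X$, in the other both equal the old $Y$. In essence
   $2XY\le X^2+Y^2$ remains. *)
rewrite !F // !G // !eqxx [y == x]eq_sym (negbTE xy).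
case: (fan e z S) => //; case: (_ && [forall s in S, ~~ e s x]);
  case: (_ && [forall s in S, ~~ e s y]); do 3 case: (_ == l) => //.
Qed.

End Fans.

Lemma nfans_pre (T T' : finType) (f : T' -> T) (e : rel T) (V : {set T'}) l :
  injective f -> nfans (relpre f e) V l = nfans e (f @: V) l.
Proof.
move=> finj; rewrite /nfans big_imset /=; last by move=> ? ? _ _ /finj.
apply: eq_bigr => z zV; rewrite -(card_imset _ (imset_inj finj)).
have fanE (S : {set T'}) : fan e (f z) (f @: S) = fan (relpre f e) z S.
  apply/fanP/fanP => -[h1 h2]; split.
  - by move=> s sS; apply/h1/imset_f.
  - by move=> u v uS vS; apply: h2; apply: imset_f.
  - by move=> _ /imsetP[s sS ->]; apply: h1.
  - by move=> _ _ /imsetP[u uS ->] /imsetP[v vS ->]; apply: h2.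
apply: eq_card => S; apply/imsetP/idP => [[A + ->]|].
  rewrite !inE => /and3P[AV Al zA]; rewrite imsetS // card_imset // Al.
  by rewrite fanE zA.
rewrite inE => /and3P[SV Sl zS].
have ES : S = f @: (f @^-1: S).
  apply/setP => s; apply/idP/imsetP => [sS|[t + ->]]; last by rewrite inE.
  by have /imsetP[t _ et] := subsetP SV _ sS; exists t; rewrite // inE -et.
exists (f @^-1: S) => //; rewrite inE -fanE -ES zS -(card_imset _ finj) -ES Sl !andbT.
apply/subsetP => t; rewrite inE => /(subsetP SV)/imsetP[t' tV /finj ->] //.
Qed.

(** * Posets whose upper summand is an antichain *)

Section Top.
Variables (T : finType) (e : rel T) (W : {set T}).

(* The order [e] is an ordinal sum whose upper summand is the antichain [W]. *)
Definition top := forall u w, w \in W -> e u w = (u \notin W).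

Hypothesis (se : strict e) (tW : top).

Lemma top_maximal w : w \in W -> maximal e w.
Proof.
move=> wW; apply/maximalP => u; case: (boolP (u \in W)) => uW; first by rewrite tW ?wW.
have uw : e u w by rewrite tW.
by apply/negP => /(se.2 _ _ _ uw); rewrite se.1.
Qed.

(** The bottom of a fan lies outside [W], whose elements are maximal. Its antichain cannot meet both
    [W] and the complement; inside [W], every [l]-subset serves every bottom outside [W]. *)
Lemma nfans_top l : 0 < l ->
  nfans e setT l = nfans e (~: W) l + #|~: W| * 'C(#|W|, l).
Proof.
move=> l0; rewrite /nfans (bigID (mem W)) /= big1 ?add0n; last first.
  by move=> z /andP[_ zW]; rewrite fans_maximal ?cards0 ?top_maximal.
rewrite -sum_nat_const -big_split /=; apply: eq_big => [z|z]; rewrite !inE //= => zW.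
rewrite -(cards_draws W l) -cardsUI [X in _ = _ + X]eq_card0 ?addn0; last first.
  move=> S; rewrite !inE; apply/negP => /andP[/and3P[SW /eqP Sl _] /andP[WS _]].
  have /card_gt0P[s sS] : 0 < #|S| by rewrite Sl.
  by have := subsetP SW _ sS; rewrite !inE (subsetP WS).
apply: eq_card => S; rewrite !inE subsetT /=; case: (#|S| == l); rewrite ?andbF //= andbT.
apply/idP/orP => [zS|[/andP[]//|SW]].
  have [/fanP[h1 h2]] := (zS, zS).
  case: (boolP (S \subset W)) => SW; [by right|left]; rewrite zS andbT.
  apply/subsetP => s sS; rewrite inE; apply: contra SW => sW; apply/subsetP => u uS.
  by have := h2 u s uS sS; rewrite tW // => /negbFE.
apply/fanP; split=> [s /(subsetP SW) sW|u v /(subsetP SW) uW /(subsetP SW) vW].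
  by rewrite tW.
by rewrite tW ?uW.
Qed.

End Top.

(** * Passing between posets with their copies and strict relations with their fans *)

Lemma strict_lt d (P : finPOrderType d) : strict (<%O : rel P).
Proof. by split; [apply: ltxx|apply: lt_trans]. Qed.

Lemma iso_subposetP d d' (P : finPOrderType d) (Q : finPOrderType d') (A : {set P}) :
  reflect (exists2 g : Q -> P, {mono g : x y / (x <= y)%O} & A = g @: setT)
          (iso (subposet A) Q).
Proof.
apply: (iffP (isoP _ _)) => [[f [h fK hK] fm]|[g gm ->]].
  exists (fun q => val (h q)).
    by move=> x y; rewrite -[RHS](congr2 _ (hK x) (hK y)) fm.
  apply/setP => x; apply/idP/imsetP => [xA|[q _ ->]]; last exact: valP.
  by exists (f (Sub x xA)); rewrite // fK.
have ginj : injective g by move=> x y xy; apply/le_anti; rewrite -!gm xy lexx.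
pose k q : subposet (g @: setT) := Sub (g q) (imset_f g (in_setT q)).
have kinj : injective k by move=> x y /(congr1 val) /ginj.
have kbij : bijective k.
  by apply: inj_card_bij => //; rewrite card_sig card_imset // cardsT.
have [j kK jK] := kbij; exists j; first by exists k.
move=> x y; rewrite -{2}(jK x) -{2}(jK y) subposet_leE /= gm //.
Qed.

Lemma nfans_card (T : finType) (e : rel T) l :
  nfans e setT l = #|[set p : T * {set T} | p.2 \in fans e setT l p.1]|.
Proof.
rewrite -sum1_card /nfans; under eq_bigr => z _ do rewrite -sum1_card.
by rewrite pair_big_dep /=; apply: eq_bigl => p; rewrite !inE.
Qed.

(** A copy is a set and a fan is a pair, but [z] is recovered from $\{z\}\cup S$ as its least
    element, so [F] matches fans with copies. *)
Lemma copies_nfans l d (P : finPOrderType d) : 0 < l ->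
  copies (osum (antichain 1) (antichain l)) P = nfans (<%O : rel P) setT l.
Proof.
move=> l0; rewrite nfans_card /copies.
pose F (p : P * {set P}) := p.1 |: p.2.
rewrite -(@card_in_imset _ _ F); last first.
  move=> [z S] [z' S']; rewrite !inE /= => /and3P[_ _ /fanP[h1 _]] /and3P[_ _ /fanP[h1' _]] /setP E.
  have ez : z = z'.
    have := E z'; have := E z; rewrite !inE !eqxx /=.
    case: eqVneq => //= _ /esym/h1' zz /h1 z'z.
    by have := lt_trans zz z'z; rewrite ltxx.
  congr pair => //; apply/setP => u; have := E u; rewrite -ez !inE.
  case: eqVneq => //= -> _; apply/idP/idP => [/h1|/h1']; rewrite ?ltxx // -ez ltxx //.
apply: eq_card => A; rewrite inE; apply/iso_subposetP/imsetP => [[g gm ->]|].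
  have ginj : injective g by move=> x y xy; apply/le_anti; rewrite -!gm xy lexx.
  have glt x y : (g x < g y)%O = (x < y)%O by rewrite !lt_def (inj_eq ginj) gm.
  exists (g (inl ord0), [set g (inr i) | i in 'I_l]).
    rewrite !inE subsetT /= card_imset ?card_ord ?eqxx; last by move=> i j /ginj [].
    apply/fanP; split=> [_ /imsetP[i _ ->]|_ _ /imsetP[i _ ->] /imsetP[j _ ->]].
      by rewrite glt lt_neqAle osum_leE.
    by rewrite glt lt_neqAle osum_leE antichain_leE; apply/negP => /andP[/negP h /eqP ij]; apply: h; rewrite ij.
  rewrite /F /=; apply/setP => x; rewrite !inE; apply/imsetP/orP => [[[i|i] _ ->]|[/eqP->|/imsetP[i _ ->]]].
  - by left; rewrite (ord1 i).
  - by right; apply: imset_f.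
  - by exists (inl ord0); rewrite ?inE.
  - by exists (inr i); rewrite ?inE.
move=> [[z S]]; rewrite !inE /F /= => /and3P[_ /eqP Sl /fanP[h1 h2]] ->.
pose g (q : osum (antichain 1) (antichain l)) :=
  if q is inr i then enum_val (cast_ord (esym Sl) i) else z.
have gS i : g (inr i) \in S by apply: enum_valP.
exists g.
  move=> [i|i] [j|j]; rewrite osum_leE.
  - by rewrite antichain_leE (ord1 i) (ord1 j) /= lexx eqxx.
  - by rewrite ltW // h1.
  - by apply/negP => h; have := lt_le_trans (h1 _ (gS i)) h; rewrite ltxx.
  - rewrite le_eqVlt h2 // orbF antichain_leE /= (inj_eq enum_val_inj).
    by rewrite (inj_eq (@cast_ord_inj _ _ _)).
apply/setP => x; rewrite !inE; apply/orP/imsetP => [[/eqP->|xS]|[[i|i] _ ->]].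
- by exists (inl ord0); rewrite ?inE.
- exists (inr (cast_ord Sl (enum_rank_in xS x))); rewrite ?inE //=.
  by rewrite cast_ordK enum_rankK_in.
- by left.
- by right.
Qed.

Section RelPoset.
Variables (T : finType) (e : rel T) (se : strict e).
(** The strictness proof is an argument of the type, so that the order instance can be read off from
    it. *)
Definition relposet of strict e : Type := T.
Local Notation rp := (relposet se).
HB.instance Definition _ := Finite.on rp.
Let le (x y : rp) := (x == y) || e x y.
Let le_refl : reflexive le. Proof. by move=> x; rewrite /le eqxx. Qed.
Let le_anti : antisymmetric le.
Proof.
move=> x y /andP[/orP[/eqP//|xy] /orP[/eqP//|yx]].
by have := se.2 _ _ _ xy yx; rewrite se.1.
Qed.
Let le_trans : transitive le.
Proof.
move=> y x z /orP[/eqP->//|xy] /orP[/eqP<-|yz]; rewrite /le ?xy ?orbT //.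
by rewrite (se.2 _ _ _ xy yz) orbT.
Qed.
HB.instance Definition _ := Order.Le_isPOrder.Build poset_display rp le_refl le_anti le_trans.

Lemma relposet_ltE (x y : rp) : (x < y)%O = e x y.
Proof.
rewrite lt_neqAle -[X in _ && X]/((x == y) || e x y).
by case: eqVneq => //= ->; rewrite se.1.
Qed.
End RelPoset.

(** * Maximal copy numbers *)

Notation fanposet l := (osum (antichain 1) (antichain l)).
Notation Mx l n := (maxcopies n (fanposet l)).

Section RelPosetCopies.
Variables (T : finType) (e : rel T) (se : strict e).
Let P : finPOrderType poset_display := relposet se.
Let f : P -> T := id.
Let g : T -> P := id.
Let fP : bijective f. Proof. by exists g. Qed.

(* The carriers agree, but their [finType] structures are not convertible. *)
Lemma card_relposet : #|P| = #|T|.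
Proof. exact: bij_eq_card fP. Qed.

Lemma copies_relposet l : 0 < l -> copies (fanposet l) P = nfans e setT l.
Proof.
move=> l0; rewrite copies_nfans //.
have -> : nfans (<%O : rel P) setT l = nfans (relpre f e) setT l.
  by apply: eq_nfans => u v _ _; rewrite relposet_ltE.
rewrite nfans_pre; last exact: bij_inj.
by congr nfans; apply/setP => x; rewrite inE; apply/imsetP; exists (g x).
Qed.

End RelPosetCopies.

Lemma nfans_le (T : finType) (e : rel T) l :
  strict e -> 0 < l -> nfans e setT l <= Mx l #|T|.
Proof.
move=> se l0; rewrite -(copies_relposet se) // -(card_relposet se).
exact: leq_maxcopies.
Qed.

Lemma nfans_sub (T : finType) (e : rel T) (V : {set T}) l :
  nfans (relpre (val : {x | x \in V} -> T) e) setT l = nfans e V l.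
Proof.
rewrite nfans_pre; last exact: val_inj; congr nfans; apply/setP => x.
apply/imsetP/idP => [[u _ ->]|xV]; first exact: valP.
by exists (Sub x xV); rewrite ?inE.
Qed.

Lemma nfans_le_sub (T : finType) (e : rel T) (V : {set T}) l :
  strict e -> 0 < l -> nfans e V l <= Mx l #|V|.
Proof.
move=> se l0; rewrite -nfans_sub -(card_sig (mem V)).
by apply: nfans_le => //; apply: strict_pre.
Qed.

Lemma copies_osum l m d (P : finPOrderType d) : 0 < l ->
  copies (fanposet l) (osum P (antichain m)) =
  copies (fanposet l) P + #|P| * 'C(m, l).
Proof.
move=> l0; rewrite !copies_nfans //; set Q := osum P _.
pose W := [set (inr i : Q) | i in setT].
have iW (x : P) : ((inl x : Q) \in W) = false by apply/negP => /imsetP[].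
have rW i : (inr i : Q) \in W by apply: imset_f; rewrite inE.
have WC : ~: W = [set (inl x : Q) | x in setT].
  apply/setP => -[x|i]; rewrite in_setC ?iW ?rW; apply/esym.
    by apply: imset_f; rewrite inE.
  by apply/negP => /imsetP[].
have ilinj : injective (inl : P -> Q) by move=> x y [].
have irinj : injective (inr : antichain m -> Q) by move=> x y [].
have tW : top (<%O : rel Q) W.
  move=> u w /imsetP[i _ ->]; case: u => [x|j]; rewrite ?iW ?rW lt_neqAle osum_leE //=.
  by rewrite antichain_leE (inj_eq irinj) andNb.
rewrite (nfans_top (strict_lt Q) tW l0) WC !card_imset // !cardsT card_ord.
congr addn; rewrite -nfans_pre //; apply: eq_nfans => u v _ _ /=.
by rewrite !lt_neqAle (inj_eq ilinj) osum_leE.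
Qed.

Lemma maxcopies_add l k m : 0 < l -> Mx l k + k * 'C(m, l) <= Mx l (k + m).
Proof.
move=> l0; have [R eR] := maxcopies_attained (fanposet l) k.
have := leq_maxcopies (fanposet l) (osum (ordered R) (antichain m) : finPOrderType _).
by rewrite copies_osum // eR card_sum !card_ord.
Qed.

(** * Repeated twinning until the maximal elements form a top antichain *)

Section Topify.
Variable T : finType.
Implicit Types (e : rel T) (u v x y : T).

Definition maxima e := [set w | maximal e w].

Lemma maximal_above e u : strict e -> ~~ maximal e u ->
  exists2 y, maximal e y & e u y.
Proof.
move=> [ei et] /forallPn[v0]; rewrite negbK => uv0.
case: (arg_minnP (fun v => #|[set t | e v t]|) uv0) => v uv vmin.
exists v => //; apply/forallP => t; apply/negP => vt.
have := vmin t (et _ _ _ uv vt); rewrite leqNgt => /negP; apply.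
apply: proper_card; apply/properP; split.
  by apply/subsetP => s; rewrite !inE => /(et _ _ _ vt).
by exists t; rewrite !inE ?vt ?ei.
Qed.

Lemma topP e (W : {set T}) :
  reflect (top e W) [forall u, forall w, (w \in W) ==> (e u w == (u \notin W))].
Proof.
apply: (iffP forallP) => h u; last by apply/forall_inP => w /h->.
by move=> w wW; apply/eqP; move/forall_inP: (h u); apply.
Qed.

(** If all maximal elements had the same elements below them, every non-maximal element, being below
    one of them, would be below all. *)
Lemma maxima_topVdiff e x : strict e -> maximal e x -> ~ top e (maxima e) ->
  exists2 y, maximal e y & exists u, e u x != e u y.
Proof.
move=> se mx; case: (boolP [exists y, maximal e y && [exists u, e u x != e u y]]).
  by move=> /existsP[y /andP[my /existsP hu]] _; exists y.
move=> h []; have {}h y u : maximal e y -> e u x = e u y.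
  move=> my; apply/eqP/negPn; apply: contra h => h.
  by apply/existsP; exists y; rewrite my; apply/existsP; exists u.
move=> u w; rewrite !inE => mw; rewrite -h //.
case: (boolP (maximal e u)) => [/maximalP -> //|mu].
by have [y my uy] := maximal_above se mu; rewrite (h y).
Qed.

Definition twins e x := [set t | maximal e t & [forall u, e u t == e u x]].

Lemma clone_twins e x y : maximal e x -> maximal e y -> (exists u, e u x != e u y) ->
  #|twins e x| < #|twins (clone y x e) x|.
Proof.
move=> mx my [u0 u0xy].
have yx : y != x by apply: contra_neq u0xy => ->.
have ny : y \notin twins e x.
  by rewrite inE my; apply/forallP => /(_ u0); rewrite eq_sym (negbTE u0xy).
rewrite -add1n -[1]/(true : nat) -ny -cardsU1; apply: subset_leq_card.
apply/subsetP => t /setU1P[->|].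
  by rewrite inE clone_maximal //; apply/forallP => u; rewrite /clone /= eqxx if_same.
rewrite !inE => /andP[mt /forallP ht]; rewrite clone_maximal //.
apply/forallP => u; rewrite /clone /= if_same; case: (t == y) => //; exact: ht.
Qed.

(** [R] is an invariant of cloning and [G] the goal, which a step may also reach directly. The
    process stops because [x] stays fixed while its class of twins grows. *)
Lemma clone_ind (R : rel T -> Prop) (G : Prop) :
  (forall e, strict e -> R e -> top e (maxima e) -> G) ->
  (forall e x y, strict e -> R e -> maximal e x -> maximal e y ->
     (exists u, e u x != e u y) -> R (clone y x e) \/ G) ->
  forall e, 0 < #|T| -> strict e -> R e -> G.
Proof.
move=> hG hS e /card_gt0P[u _] se Re.
have [x mx] : exists x, maximal e x.
  case: (boolP (maximal e u)) => [|/(maximal_above se)[x]]; first by exists u.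
  by exists x.
have [N] := ubnP (#|T| - #|twins e x|).
elim: N e se Re mx => // N IH e se Re mx leN.
case: (topP e (maxima e)) => [|nt]; first exact: hG.
have [y my hy] := maxima_topVdiff se mx nt.
have [Rc|//] := hS _ _ _ se Re mx my hy.
apply: IH Rc _ _; [exact: strict_pre|exact: clone_maximal|].
have : #|twins (clone y x e) x| <= #|T| := max_card _.
have := clone_twins mx my hy; lia.
Qed.

End Topify.

(** By [clone_convex] both clones of an optimal order are optimal, so optimality is an invariant for
    [clone_ind]. *)
Lemma exists_top_opt (T : finType) l : 0 < l -> 0 < #|T| ->
  exists e : rel T, [/\ strict e, nfans e setT l = Mx l #|T| & top e (maxima e)].
Proof.
move=> l0 T0; have [R eR] := maxcopies_attained (fanposet l) #|T|.
pose e : rel T := relpre (enum_rank : T -> ordered R) <%O.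
have se : strict e by apply: strict_pre (strict_lt _).
apply: (clone_ind (R := fun e => nfans e setT l = Mx l #|T|)) T0 se _.
- by move=> e' se' Re' te'; exists e'.
- move=> e' x y se' Re' mx my [u uxy]; left.
  have xy : x != y by apply: contra_neq uxy => ->.
  have := clone_convex l0 xy mx my; rewrite Re'.
  have h z t : nfans (clone z t e') setT l <= Mx l #|T|.
    by apply: nfans_le => //; apply: strict_pre.
  have := h x y; have := h y x; lia.
- rewrite -eR copies_nfans // nfans_pre; last exact: enum_rank_inj.
  congr nfans; apply/setP => i; rewrite inE; apply/imsetP; exists (enum_val i) => //.
  by rewrite enum_valK.
Qed.

(** * The recursion for $M_n$ *)

Lemma bin_add_lt a b l : 0 < l <= a -> 0 < b -> 'C(a, l) < 'C(a + b, l).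
Proof.
case: l => // l; case: b => // b /andP[_ la] _; apply: (@leq_trans 'C(a.+1, l.+1)).
  by rewrite binS -addn1 leq_add2l bin_gt0 ltnW.
by apply: leq_bin2l; lia.
Qed.

Lemma maxcopies0 l : 0 < l -> Mx l 0 = 0.
Proof.
move=> l0; have [R eR] := maxcopies_attained (fanposet l) 0.
by rewrite -eR copies_nfans // /nfans big1 // => -[].
Qed.

(** The side conditions make $k\binom{m}{l}$ positive, so the upper antichain really contributes
    copies. *)
Definition decomposable l n :=
  exists k m, [/\ n = k + m, l <= m, 0 < k & Mx l n = Mx l k + k * 'C(m, l)].

(** With $m<l$ the top antichain would contribute nothing, whereas merging it into the top antichain
    of a decomposition of [k] would gain copies. *)
Lemma decomposable_dims l k m : 0 < l -> 0 < m -> (0 < Mx l k -> decomposable l k) ->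
  Mx l (k + m) = Mx l k + k * 'C(m, l) -> 0 < Mx l (k + m) -> l <= m /\ 0 < k.
Proof.
move=> l0 m0 dk E M0; split; last first.
  by case: posnP => // k0; move: M0; rewrite E k0 maxcopies0.
rewrite leqNgt; apply/negP => ml; rewrite bin_small // muln0 addn0 in E.
have [|k' [m' [kE lm k0' Mk']]] := dk; first by rewrite -E.
have := maxcopies_add k' (m' + m) l0; rewrite addnA -kE E Mk'.
have := @bin_add_lt m' m l; rewrite l0 lm => /(_ isT m0); nia.
Qed.

(** The maximum for the lower part and [maxcopies_add] squeeze the count of [nfans_top], so equality
    holds throughout. *)
Lemma nfans_top_opt (T : finType) (e : rel T) (W : {set T}) l :
  0 < l -> strict e -> top e W -> nfans e setT l = Mx l #|T| ->
  nfans e (~: W) l = Mx l #|~: W| /\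
  Mx l #|T| = Mx l #|~: W| + #|~: W| * 'C(#|W|, l).
Proof.
move=> l0 se tW eM; have := nfans_top se tW l0; have := nfans_le_sub (~: W) se l0.
have := maxcopies_add #|~: W| #|W| l0; rewrite [#|~: W| + _]addnC cardsC eM; lia.
Qed.

Lemma maxima_gt0 (T : finType) (e : rel T) : strict e -> 0 < #|T| -> 0 < #|maxima e|.
Proof.
move=> se /card_gt0P[u _]; apply/card_gt0P.
case: (boolP (maximal e u)) => [|/(maximal_above se)[x]]; first by exists u; rewrite inE.
by exists x; rewrite inE.
Qed.

Lemma maxcopies_rec l n : 0 < l -> 0 < Mx l n -> decomposable l n.
Proof.
move=> l0; have [N] := ubnP n; elim: N n => // N IH n nN M0.
have n0 : 0 < n by case: posnP => // n0; rewrite n0 maxcopies0 in M0.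
have : 0 < #|'I_n| by rewrite card_ord.
case/(exists_top_opt l0) => e [se eM te].
have := maxima_gt0 se; rewrite card_ord => /(_ n0).
have := cardsC (maxima e); have [_] := nfans_top_opt l0 se te eM; rewrite card_ord.
set m := #|maxima e|; set k := #|~: maxima e| => Mk mk m0.
rewrite addnC in mk; rewrite -mk in Mk M0 nN.
have [|lm k0] := decomposable_dims l0 m0 _ Mk M0.
  by move=> Mk0; apply: IH => //; lia.
by rewrite -mk; exists k, m.
Qed.

Lemma maxcopies_small l n : 0 < l -> n <= l -> Mx l n = 0.
Proof.
by move=> l0 nl; case: (posnP (Mx l n)) => // /(maxcopies_rec l0)[k [m [nE lm k0 _]]]; lia.
Qed.

(** * Exchanging one element of the top antichain *)

Section Exchange.
Variables (T : finType) (e : rel T) (l : nat) (W : {set T}) (x y : T).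
Hypotheses (se : strict e) (l2 : 1 < l) (my : maximal e y) (yW : y \in W).
Hypothesis tW : top (clone y x e) W.

(** [Y] holds the possible bottoms of fans through [y], and [W'] the other elements of [W] that are
    incomparable to [y]. Adding [y] to a set in [H z] with [z] in [Y] gives a fan, and [G] is the
    number of these mixed fans. *)
Let Y := [set z in ~: W | e z y].
Let W' := [set w in W | (w != y) && ~~ e w y].
Let H z := [set A in fans e (~: W) l.-1 z | [forall a in A, ~~ e a y]].
Let G := \sum_(z in Y) #|H z|.

Let e_W u w : w \in W -> w != y -> e u w = (u \notin W).
Proof.
move=> wW wy; case: (eqVneq u y) => [->|uy]; first by rewrite yW; move/maximalP: my.
by rewrite -(tW u wW) /clone /= (negbTE uy) (negbTE wy).
Qed.

Let W_e u v : u \in W -> v != y -> e u v = false.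
Proof.
move=> uW vy; case: (eqVneq u y) => [->|uy]; first by move/maximalP: my.
have sc : strict (clone y x e) by apply: strict_pre.
by have /maximalP/(_ v) := top_maximal sc tW uW; rewrite /clone /= (negbTE uy) (negbTE vy).
Qed.

Let Wy u : u \notin W -> u != y.
Proof. by apply: contraNneq => ->. Qed.

Lemma nfans_clone :
  nfans (clone y x e) setT l = nfans e (~: W) l + #|~: W| * 'C(#|W|, l).
Proof.
have sc : strict (clone y x e) by apply: strict_pre.
rewrite (nfans_top sc tW (ltnW l2)).
congr addn; apply: eq_nfans => u v; rewrite !inE => /Wy uy /Wy vy.
by rewrite /clone /= (negbTE uy) (negbTE vy).
Qed.

(* An antichain meeting both [W] and its complement must meet [W] in [y] only;
   such antichains are the ones counted by [G]. *)
Lemma nfans_exchange_le : nfans e setT l <=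
  nfans e (~: W) l + #|~: W| * 'C(#|W|.-1, l) + #|Y| * 'C(#|W'|, l.-1) + G.
Proof.
have -> : #|Y| * 'C(#|W'|, l.-1) = \sum_(z in ~: W | e z y) 'C(#|W'|, l.-1).
  by rewrite -sum_nat_const; apply: eq_bigl => z; rewrite !inE.
have -> : G = \sum_(z in ~: W | e z y) #|H z|.
  by apply: eq_bigl => z; rewrite !inE.
rewrite -addnA -big_split /= -sum_nat_const !big_mkcondr /= -!big_split /=.
(* An element of [W] can only be below [y], so it is the bottom of no fan with $l\ge2$ upper
   elements. *)
rewrite {1}/nfans (bigID (mem W)) /= big1 ?add0n => [|z /andP[_ zW]]; last first.
  apply: eq_card0 => S; rewrite !inE subsetT /=; apply/negP => Sl.
  case/andP: Sl => /eqP Sl /fanP[h _].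
  have : S \subset [set y].
    apply/subsetP => s /h; rewrite inE; apply: contraTT => sy; by rewrite W_e.
  by move/subset_leq_card; rewrite Sl cards1 leqNgt l2.
rewrite [X in X <= _](eq_bigl (mem (~: W))); last by move=> z; rewrite !inE.
apply: leq_sum => z; rewrite inE => zW.
have -> : #|W|.-1 = #|W :\ y| by rewrite (cardsD1 y W) yW.
rewrite -(cards_draws (W :\ y)) -(cards_draws W').
set D := [set _ | _ & _]; set B := [set _ | _ & _].
(* Besides the antichains inside the complement of [W] and those inside [W] without [y], there are
   those that contain [y]: their remainder lies in [W'] or belongs to [H z]. *)
pose U := if e z y then [set y |: A | A in B] :|: [set y |: A | A in H z] else set0.
apply: (@leq_trans #|fans e (~: W) l z :|: D :|: U|); last first.
  apply: leq_trans (leq_card_setU _ _) _; apply: leq_add; first exact: leq_card_setU.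
  rewrite /U; case: ifP => _; rewrite ?cards0 //.
  by apply: leq_trans (leq_card_setU _ _) _; apply: leq_add; apply: leq_imset_card.
apply/subset_leq_card/subsetP => S; rewrite !inE subsetT /= => /andP[Sl zS].
have /fanP[h1 h2] := zS.
have SW w : w \in S -> w \in W -> w != y -> S \subset W.
  by move=> wS wW wy; apply/subsetP => u uS; have := h2 _ _ uS wS; rewrite e_W // => /negbFE.
rewrite Sl zS !andbT; case: (boolP (S \subset ~: W)) => //= /subsetPn[w wS].
rewrite inE negbK => wW; case: (boolP (y \in S)) => yS; last first.
  have wy : w != y by apply: contraNneq yS => <-.
  by rewrite subsetD1 (SW w) // yS.
apply/orP; right; rewrite /U h1 // !inE -{1 2}(setD1K yS).
have hA : #|S :\ y| == l.-1 by move: Sl; rewrite (cardsD1 y) yS => /eqP <-.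
have hy a : a \in S :\ y -> ~~ e a y by rewrite !inE => /andP[_ aS]; rewrite h2.
case: (boolP (S :\ y \subset ~: W)) => [AW|/subsetPn[w' w'S]].
  rewrite orbC imset_f // !inE AW hA /=; apply/andP; split; last exact/forall_inP.
  apply/fanP; split=> [s|u v]; rewrite !inE; first by case/andP=> _ /h1.
  by case/andP=> _ uS /andP[_ vS]; apply: h2.
rewrite inE negbK => w'W; rewrite imset_f // inE hA andbT.
move: w'S; rewrite !inE => /andP[w'y w'S].
apply/subsetP => a aS; have := hy _ aS; move: aS; rewrite !inE => /andP[-> aS] ->.
by rewrite (subsetP (SW _ w'S w'W w'y)).
Qed.

(* Every element of [W] becomes a copy of [y]. *)
Definition collapse : rel T := relpre (fun u => if u \in W then y else u) e.

(** Each [z] in [Y] is now below all of [W], hence below every [l]-subset of it. Each set in [H z]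
    may be completed by any of the #|W| copies of [y] instead of by [y] alone. These families of
    fans are disjoint. *)
Lemma nfans_collapse_ge :
  nfans e (~: W) l + #|Y| * 'C(#|W|, l) + #|W| * G <=
  nfans collapse setT l.
Proof.
have -> : #|Y| * 'C(#|W|, l) = \sum_(z in ~: W | e z y) 'C(#|W|, l).
  by rewrite -sum_nat_const; apply: eq_bigl => z; rewrite !inE.
have -> : #|W| * G = \sum_(z in ~: W | e z y) #|W| * #|H z|.
  by rewrite /G big_distrr; apply: eq_bigl => z; rewrite !inE.
set e' := collapse.
rewrite -addnA -big_split /= !big_mkcondr /= -!big_split /=.
apply: (@leq_trans (\sum_(z in ~: W) #|fans e' setT l z|)); last first.
  rewrite [X in _ <= X](bigID (mem (~: W))) /=.
  rewrite (eq_bigl (fun z => (z \in setT) && (z \in ~: W))) ?leq_addr // => z.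
  by rewrite in_setT.
apply: leq_sum => z; rewrite inE => zW.
pose F (p : T * {set T}) := p.1 |: p.2.
pose U := if e z y then [set S : {set T} | S \subset W & #|S| == l] :|:
                        (F @: setX W (H z)) else set0.
have e'zW w : w \in W -> e' z w = e z y by rewrite /e' /collapse /= (negbTE zW) => ->.
have e'C u v : u \notin W -> v \notin W -> e' u v = e u v.
  by rewrite /e' /collapse /= => /negbTE -> /negbTE ->.
have We' u v : u \in W -> e' u v = false.
  by rewrite /e' /collapse /= => ->; move/maximalP: my.
apply: (@leq_trans #|fans e (~: W) l z :|: U|); last first.
  apply/subset_leq_card/subsetP => S; rewrite inE => /orP[|].
    rewrite !inE subsetT => /and3P[/subsetP SW -> zS] /=.
    rewrite -(@eq_fan _ e e') // => u v uS /SW; rewrite inE => vW.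
    by apply/esym/e'C => //; case/setU1P: uS => [->|/SW]; rewrite ?inE.
  rewrite /U; case: ifP => [zy|]; rewrite ?inE // subsetT => /orP[/andP[/subsetP SW ->]|].
    by apply/fanP; split=> [s /SW /e'zW -> //|u v /SW uW _]; rewrite We'.
  case/imsetP => -[w A]; rewrite !inE /F /= => /andP[wW /andP[/and3P[/subsetP AW /eqP Al zA]]].
  move=> /forall_inP hA ->; have {}AW a : a \in A -> a \notin W by move/AW; rewrite inE.
  have wA : w \notin A by apply: contraL wW => /AW.
  rewrite cardsU1 wA Al add1n (prednK (ltnW l2)) eqxx /=.
  have /fanP[h1 h2] := zA.
  apply/fanP; split=> [s /setU1P[->|sA]|u v /setU1P[->|uA] /setU1P[->|vA]].
  - by rewrite e'zW.
  - by rewrite e'C //; [apply: h1|apply: AW].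
  - exact: We'.
  - exact: We'.
  - by rewrite /e' /collapse /= wW (negbTE (AW _ uA)) (negbTE (hA _ uA)).
  - by rewrite e'C //; [apply: h2|apply: AW|apply: AW].
have disj (A B : {set {set T}}) : (forall S, S \in A -> S \in B -> false) ->
    #|A :|: B| = #|A| + #|B|.
  move=> h; rewrite -cardsUI [X in _ = _ + X]eq_card0 ?addn0 // => S.
  by rewrite inE; apply/negP => /andP[SA /(h _ SA)].
have nz (S : {set T}) : #|S| == l -> exists s, s \in S.
  by move/eqP=> Sl; apply/card_gt0P; rewrite Sl (ltnW l2).
rewrite disj; last first.
  move=> S; rewrite inE => /and3P[/subsetP SW Sl _].
  rewrite /U; case: ifP => _; rewrite ?inE // => /orP[/andP[/subsetP SW' _]|].
    by have [s sS] := nz _ Sl; have := SW s sS; rewrite inE SW'.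
  case/imsetP=> -[w A]; rewrite inE /F => /andP[wW _] ES.
  by have := SW w; rewrite ES !inE eqxx wW => /(_ isT).
apply: leq_add => //; rewrite /U; case: ifP => // zy; rewrite disj; last first.
  move=> S; rewrite inE => /andP[/subsetP SW Sl] /imsetP[[w A]].
  rewrite !inE /F /= => /andP[wW /andP[/and3P[/subsetP AW /eqP Al _] _]] ES.
  have /card_gt0P[a aA] : 0 < #|A| by rewrite Al -subn1 subn_gt0.
  by have := AW a aA; rewrite inE SW // ES inE aA orbT.
rewrite cards_draws leq_add2l card_in_imset ?cardsX //.
move=> [w A] [w' A']; rewrite !inE /F /=.
move=> /andP[wW /andP[/and3P[/subsetP AW _ _] _]] /andP[w'W /andP[/and3P[/subsetP AW' _ _] _]] /setP E.
have {}AW a : a \in W -> (a \in A) = false.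
  by move=> aW; apply/negP => /AW; rewrite inE aW.
have {}AW' a : a \in W -> (a \in A') = false.
  by move=> aW; apply/negP => /AW'; rewrite inE aW.
have ew : w = w' by have := E w; rewrite !inE eqxx AW' // orbF => /esym/eqP.
congr pair => //; apply/setP => a; have := E a; rewrite -ew !inE.
by case: eqVneq => //= ->; rewrite AW ?AW'.
Qed.

End Exchange.

(** * Binomial estimates and small top antichains in optimal decompositions *)

Lemma leq_bin n i : 0 < i < n -> n <= 'C(n, i).
Proof.
elim: n i => // n IH [//|i] /= ni; rewrite binS.
have [ni'|] := ltnP i.+1 n.
  have := IH i.+1 ni'; have : 0 < 'C(n, i) by (rewrite bin_gt0; lia).
  lia.
move=> ?; have -> : n = i.+1 by lia.
by rewrite binn binSn add1n.
Qed.

(** The left side counts the subsets with at most one of the [j] new elements. *)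
Lemma bin_gain m j l : 'C(m, l.+1) + j * 'C(m, l) <= 'C(m + j, l.+1).
Proof.
elim: j => [|j IH]; first by rewrite mul0n !addn0.
have : 'C(m, l) <= 'C(m + j, l) by apply: leq_bin2l; apply: leq_addr.
rewrite addnS binS mulSn; lia.
Qed.

(** For $k>1$ a larger top antichain wins: $\mathcal{A}_1\oplus\mathcal{A}_{l+k-1}$ if $M_k=0$, and
    otherwise the merger of $\mathcal{A}_l$ with the top antichain of a decomposition of [k]. *)
Lemma maxcopies_top_l l k : 1 < l -> 0 < k -> Mx l (k + l) = Mx l k + k -> k = 1.
Proof.
move=> l2 k0 E; case: (posnP (Mx l k)) => [Mk0|/(maxcopies_rec (ltnW l2))].
  have := maxcopies_add 1 (l + k.-1) (ltnW l2).
  have -> : 1 + (l + k.-1) = k + l by lia.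
  rewrite E Mk0 maxcopies_small; [|lia|lia].
  have := bin_gain l k.-1 l.-1; rewrite prednK; last lia.
  rewrite binn -[in X in _ * X](prednK (ltnW l2)) /= binSn; nia.
move=> [k' [m' [kE lm k0' Mk]]].
have := maxcopies_add k' (m' + l) (ltnW l2); rewrite addnA -kE E Mk.
have := bin_gain m' l l.-1; rewrite prednK; last lia.
have D : m' <= 'C(m', l.-1) by apply: leq_bin; lia.
have := leq_mul l2 D; move: ('C(m', l.-1)) ('C(m', l)) ('C(m' + l, l)) => c1 c2 c3.
move=> h1 h2; have := leq_mul (leqnn k') (leq_trans (leq_add (leqnn c2) h1) h2).
rewrite kE mulnDr; have : m' <= k' * m' by rewrite leq_pmull.
have : k' * 2 <= k' * m' by rewrite leq_mul2l; apply/orP; right; lia.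
lia.
Qed.

Lemma maxcopies_top_3 k : Mx 2 (k + 3) = Mx 2 k + k * 3 -> k <= 2.
Proof.
move=> E; rewrite leqNgt; apply/negP => k2.
case: (posnP (Mx 2 k)) => [Mk0|/(maxcopies_rec (isT : 0 < 2))[k' [m' [kE lm k0' Mk]]]].
  (* The competitor is $\mathcal{A}_1\oplus\mathcal{A}_{k+2}$. *)
  have := maxcopies_add 1 (k + 2) (isT : 0 < 2).
  have -> : 1 + (k + 2) = k + 3 by lia.
  rewrite E Mk0 (@maxcopies_small 2 1) //.
  have := bin_gain k 1 1; have := bin_gain k.+1 1 1; have := bin_gain 3 (k - 3) 1.
  rewrite addn2 !addn1 !bin1 subnKC //; have -> : 'C(3, 2) = 3 by [].
  lia.
(* Two competitors: merging $\mathcal{A}_3$ with $\mathcal{A}_{m'}$ rules out $k'\ge2$, and moving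
   one element of $\mathcal{A}_{m'}$ up to form $\mathcal{A}_4$ rules out $k'=1$. *)
have := maxcopies_add k' (m' + 3) (isT : 0 < 2); rewrite addnA -kE E Mk.
have := maxcopies_add (k' + (m' - 1)) 4 (isT : 0 < 2).
have -> : k' + (m' - 1) + 4 = k + 3 by lia.
have := maxcopies_add k' (m' - 1) (isT : 0 < 2).
have : 'C(m' + 3, 2) = 'C(m', 2) + m' * 3 + 3 by rewrite addn3 !binS !bin1 !bin0; lia.
have : 'C(m', 2) = 'C(m' - 1, 2) + (m' - 1).
  by case: m' {kE Mk} lm => // a _; rewrite subn1 binS bin1.
rewrite E Mk kE; have -> : 'C(4, 2) = 6 by [].
have [->|k1] : k' = 1 \/ 2 <= k' by lia.
  lia.
move: ('C(m', 2)) ('C(m' - 1, 2)) ('C(m' + 3, 2)) => c1 c2 c3; nia.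
Qed.

(* Here [k] and [m] are the sizes of the two summands of the optimal poset; with
   [q = k - p] and [B = 'C(m.-1, l.-1)] the hypotheses give [q * B <= G + eps] and
   [l * G <= q * B], so that [(l - 1) * G <= eps]. *)
Lemma exchange_arith l k m p w G c cx M eps : 1 < l -> l <= m -> 0 < k -> p <= k ->
  eps <= 1 -> M = c + k * 'C(m, l) ->
  cx <= c + k * 'C(m.-1, l) + p * 'C(w, l.-1) + G ->
  c + p * 'C(m, l) + m * G <= M -> M <= cx + eps ->
  w <= m.-1 -> (p = k -> w <= m.-2) ->
  eps = 1 /\ [\/ k = 1 /\ l = 2, m = l | l = 2 /\ m = 3].
Proof.
(* From here on [l] and [m] stand for the original values minus two. *)
case: l m => [|[|l]] // [|[|m]] // _ /=; rewrite !ltnS => lm k0 pk e1 -> U L C wm wm'.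
have bE : 'C(m.+2, l.+2) = 'C(m.+1, l.+2) + 'C(m.+1, l.+1) by rewrite binS.
have b1 : 0 < 'C(m, l) by rewrite bin_gt0.
(* If $p=k$, the collapsed poset already attains the maximum unless $G=0$, and the sharper bound on
   [w] leaves a loss of at least $k\binom{m-2}{l-2}$ in the original values. *)
have [pk'|pk'] := eqVneq p k.
  have G0 : G = 0.
    case: G U L C => // G _ L _; move: L; rewrite pk' -[X in _ <= X]addn0 leq_add2l.
    by rewrite mulnS.
  have cw : 'C(w, l.+1) <= 'C(m, l.+1) by apply/leq_bin2l/wm'.
  have bE' : 'C(m.+1, l.+1) = 'C(m, l.+1) + 'C(m, l) by rewrite binS.
  have h : k * 'C(m, l) <= eps.
    have := leq_trans C (leq_add U (leqnn eps)).
    have : p * 'C(w, l.+1) <= k * 'C(m, l.+1) by rewrite pk' leq_mul2l cw orbT.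
    rewrite bE bE' G0 !mulnDr; lia.
  have k1 : k <= eps by apply: leq_trans h; rewrite leq_pmulr.
  have b1' : 'C(m, l) <= eps by apply: leq_trans h; rewrite leq_pmull.
  split; first lia.
  move: lm b1' {U L C wm wm' bE b1 cw bE' h}; case: l => [|l] lm b1'; first by constructor 1; split=> //; lia.
  constructor 2; congr _.+2; apply/eqP; rewrite eqn_leq lm andbT leqNgt.
  apply/negP => lm'; have := @leq_bin m l.+1; rewrite lm' => /(_ isT); lia.
have cw : 'C(w, l.+1) <= 'C(m.+1, l.+1) by apply/leq_bin2l.
have B1 : 0 < 'C(m.+1, l.+1) by rewrite bin_gt0.
(* The identity $m\binom{m-1}{l-1}=l\binom{m}{l}$, in the original values, turns $mG\le
   q\binom{m}{l}$ into $lG\le qB$. *)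
have d := mul_bin_diag m.+2 l.+1; rewrite /= in d.
have [q kE] : exists q, k = p + q by exists (k - p); lia.
have q0 : 0 < q by lia.
have cw' := leq_mul (leqnn p) cw.
rewrite kE in U L C pk'.
have hB : m != l -> m < 'C(m.+1, l.+1) by move=> ?; apply: leq_bin; lia.
move: cw' B1 d bE hB U C L; move: 'C(m.+2, l.+2) 'C(m.+1, l.+2) 'C(m.+1, l.+1) => C2 C1 B.
move=> cw' B1 d bE hB U C L.
have h1 : q * B <= G + eps by move: U C; rewrite bE !mulnDl !mulnDr; lia.
have h2 : m.+2 * G <= q * C2 by move: L; rewrite !mulnDl; lia.
have h3 : l.+2 * G <= q * B.
  rewrite -(leq_pmul2l (isT : 0 < m.+2)) mulnCA.
  have -> : m.+2 * (q * B) = l.+2 * (q * C2) by rewrite mulnCA d mulnCA.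
  by rewrite leq_mul2l h2 orbT.
have qB0 : 0 < q * B by rewrite muln_gt0 q0.
have h4 : B <= q * B by rewrite leq_pmull.
rewrite !mulSn in h3.
split; first lia.
(* In the original values, $m\ne l$ gives $B\ge m-1\ge2$, so $G>0$. Then $(l-1)G\le1$ forces $l=2$
   and $G=1$, and $B\le2$ leaves $m=3$. *)
have [ml|ml] := eqVneq m l; first by constructor 2; rewrite ml.
have hBm := hB ml; have G0 : 0 < G by lia.
have lG : l <= l * G by rewrite leq_pmulr.
by constructor 3; split; lia.
Qed.

(* [eps = 0] is used for the structure of optimal posets, [eps = 1] for the posets
   with one copy less than the maximum. *)
Lemma exchange_opt (T : finType) (e : rel T) l x y (W : {set T}) eps :
  1 < l -> strict e -> maximal e x -> maximal e y -> (exists u, e u x != e u y) ->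
  x \in W -> y \in W -> top (clone y x e) W ->
  nfans (clone y x e) setT l = Mx l #|T| -> 0 < Mx l #|T| -> eps <= 1 ->
  nfans e setT l + eps = Mx l #|T| ->
  eps = 1 /\ (#|T| = l.+1 \/ l = 2 /\ #|T| <= 5).
Proof.
move=> l2 se mx my [u uxy] xW yW tW cM M0 e1 eM; have l0 := ltnW l2.
have xy : x != y by apply: contra_neq uxy => ->.
have sc : strict (clone y x e) by apply: strict_pre.
have nT : #|~: W| + #|W| = #|T| by rewrite addnC cardsC.
have [ME MT] := nfans_top_opt l0 sc tW cM.
have cE := nfans_clone se l2 yW tW; rewrite cM in cE.
have U := nfans_exchange_le se l2 my yW tW.
have := nfans_collapse_ge W l2 my.
set Y := [set z in ~: W | e z y] in U *; set G := \sum_(z in Y) _ in U *.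
set w := #|[set _ | _]| in U.
have := @nfans_le T (collapse e W y) l (strict_pre _ se) l0.
move=> Lm /leq_trans /(_ Lm) L {Lm}.
have W0 : 0 < #|W| by apply/card_gt0P; exists x.
rewrite -nT in MT M0.
have [lm k0] := decomposable_dims l0 W0 (@maxcopies_rec l _ l0) MT M0.
rewrite nT in MT M0.
have pk : #|Y| <= #|~: W| by apply/subset_leq_card/subsetP => z; rewrite inE => /andP[].
have ww : w <= #|W|.-1.
  rewrite [#|W|](cardsD1 y) yW; apply/subset_leq_card/subsetP => z.
  by rewrite !inE => /and3P[-> ->].
(* If [y] is above the whole complement of [W], the element [u] separating [x] from [y] lies in [W]
   below [y], so the set counted by [w] misses both [y] and [u]. *)
have ww' : #|Y| = #|~: W| -> w <= #|W|.-2.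
  move=> YW; have YE : Y = ~: W.
    apply/eqP; rewrite eqEcard YW leqnn andbT; apply/subsetP => z.
    by rewrite inE => /andP[].
  have ux : e u x = (u \notin W).
    case: (eqVneq u y) => [->|uy]; first by rewrite yW; move/maximalP: my.
    by rewrite -(tW u x xW) /clone /= (negbTE uy) (negbTE xy).
  have uW : u \in W.
    apply: contraR uxy => uW; rewrite ux uW; have : u \in Y by rewrite YE inE.
    by rewrite inE => /andP[_ ->].
  have uy : e u y by move: uxy; rewrite ux uW /=; case: (e u y).
  have uny : u != y by apply: contraTneq uy => ->; rewrite se.1.
  rewrite (cardsD1 y W) yW (cardsD1 u (W :\ y)) !inE uW uny.
  apply/subset_leq_card/subsetP => z; rewrite !inE => /and3P[-> -> zy]; rewrite !andbT.
  by apply: contraNneq zy => ->.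
rewrite -eM in L cE.
have [-> [[k1 l2']|ml|[l2' m3]]] := exchange_arith l2 lm k0 pk e1 cE U L (leqnn _) ww ww'.
- split=> //; right; split=> //; rewrite -nT k1 l2' in MT *.
  (* Comparison with $\mathcal{A}_2\oplus\mathcal{A}_{m-1}$, where $m$ is the size of [W], gives
     $\binom{m-1}{2}\le m-1$, hence $m\le4$. *)
  have := maxcopies_add 2 (#|W| - 1) (isT : 0 < 2).
  have -> : 2 + (#|W| - 1) = 1 + #|W| by lia.
  rewrite MT !(@maxcopies_small 2) // add0n mul1n.
  have [//|m5] := leqP (1 + #|W|) 5.
  have -> : 'C(#|W|, 2) = 'C(#|W| - 1, 2) + (#|W| - 1).
    by case: (#|W|) m5 => // a _; rewrite subn1 binS bin1.
  have := bin_gain 3 (#|W| - 4) 1; have -> : 3 + (#|W| - 4) = #|W| - 1 by lia.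
  have -> : 'C(3, 2) = 3 by [].
  rewrite bin1; lia.
- split=> //; left; rewrite -nT ml in MT *.
  by rewrite (maxcopies_top_l l2 k0 _) // MT binn muln1.
- split=> //; right; split=> //; rewrite -nT l2' m3 in MT *.
  by have := maxcopies_top_3 MT; lia.
Qed.

(** * Top antichains in optimal and nearly optimal posets *)

Lemma opt_top (T : finType) (e : rel T) l : 1 < l -> 0 < #|T| -> strict e ->
  0 < Mx l #|T| -> nfans e setT l = Mx l #|T| -> top e (maxima e).
Proof.
move=> l2 T0 se M0 eM; case: (topP e (maxima e)) => // nt; have l0 := ltnW l2.
apply: False_ind.
(* The invariant contradicts the final state of the process. It persists because [exchange_opt] with
   $eps=0$ forbids a step from an optimal poset to an optimal one with a top antichain. *)
apply: (clone_ind (R := fun e => nfans e setT l = Mx l #|T| /\ ~ top e (maxima e)))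
  T0 se (conj eM nt) => {e eM nt}.
  by move=> e _ [].
move=> e x y se [eM nt] mx my hxy; have [u uxy] := hxy; left.
have xy : x != y by apply: contra_neq uxy => ->.
have cM : nfans (clone y x e) setT l = Mx l #|T|.
  have := clone_convex l0 xy mx my; rewrite eM.
  have h z t : nfans (clone z t e) setT l <= Mx l #|T|.
    by apply: nfans_le => //; apply: strict_pre.
  have := h x y; have := h y x; lia.
split=> // tc.
have [||||] := exchange_opt (eps := 0) l2 se mx my hxy _ _ tc cM M0; rewrite ?addn0 //.
all: by rewrite inE clone_maximal.
Qed.

(** The two clones have at least $2M_n-2$ copies together. Outside the exceptional sizes neither
    reaches $M_n$, so both have exactly $M_n-1$. *)
Lemma near_opt_top (T : finType) (e : rel T) l : 1 < l -> strict e ->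
  (nfans e setT l).+1 = Mx l #|T| -> #|T| <> l.+1 -> ~ (l = 2 /\ #|T| <= 5) ->
  exists e' : rel T,
    [/\ strict e', (nfans e' setT l).+1 = Mx l #|T| & top e' (maxima e')].
Proof.
move=> l2 se eM nl n5; have l0 := ltnW l2.
have M0 : 0 < Mx l #|T| by rewrite -eM.
have T0 : 0 < #|T| by case: (posnP #|T|) => // T0; rewrite T0 maxcopies0 in M0.
apply: (clone_ind (R := fun e => (nfans e setT l).+1 = Mx l #|T|)) T0 se eM.
  by move=> e' se' Re' te'; exists e'.
move=> {e} e x y se eM mx my [u uxy].
have xy : x != y by apply: contra_neq uxy => ->.
have T0 : 0 < #|T| by apply/card_gt0P; exists x.
(* A clone attaining the maximum has a top antichain by [opt_top], and [exchange_opt] then confines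
   #|T| to the excluded sizes. *)
have no a b : maximal e a -> maximal e b -> e u a != e u b ->
    nfans (clone b a e) setT l = Mx l #|T| -> False.
  move=> ma mb uab cM; have sc : strict (clone b a e) by apply: strict_pre.
  have tc := opt_top l2 T0 sc M0 cM.
  have [|||||_ [/nl//|/n5//]] := exchange_opt (eps := 1) l2 se ma mb _ _ _ tc cM M0.
  - by exists u.
  - by rewrite inE clone_maximal.
  - by rewrite inE clone_maximal.
  - by [].
  - by rewrite addn1.
have h z t : nfans (clone z t e) setT l <= Mx l #|T|.
  by apply: nfans_le => //; apply: strict_pre.
have c := clone_convex l0 xy mx my; have h1 := h x y; have h2 := h y x.
have n1 := no _ _ mx my uxy; rewrite eq_sym in uxy.
have n2 := no _ _ my mx uxy; left; lia.
Qed.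

(** * Isomorphisms, layered posets and permutation posets *)

Section Iso.
Context {d1 d2 d3 : Order.disp_t}.
Variables (P : finPOrderType d1) (Q : finPOrderType d2) (S : finPOrderType d3).

Lemma iso_emb (f : P -> Q) :
  {mono f : x y / (x <= y)%O} -> #|Q| <= #|P| -> iso P Q.
Proof.
move=> fm QP; apply/isoP; exists f => //; apply: inj_card_bij QP.
by move=> x y xy; apply/le_anti; rewrite -!fm xy lexx.
Qed.

Lemma iso_card : iso P Q -> #|P| = #|Q|.
Proof. by case/isoP=> f /bij_eq_card. Qed.

Lemma iso_trans : iso P Q -> iso Q S -> iso P S.
Proof.
move=> /isoP[f fb fm] /isoP[g gb gm]; apply/isoP; exists (g \o f).
  exact: bij_comp.
by move=> x y /=; rewrite gm fm.
Qed.

Lemma iso_sym : iso P Q -> iso Q P.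
Proof.
move=> /isoP[f [g fK gK] fm]; apply/isoP; exists g; first by exists f.
by move=> x y; rewrite -fm !gK.
Qed.

Lemma card_osum : #|{: osum P Q}| = #|P| + #|Q|. Proof. exact: card_sum. Qed.
End Iso.

Section IsoOsum.
Context {d1 d2 d3 : Order.disp_t}.
Variables (P : finPOrderType d1) (Q : finPOrderType d2) (S : finPOrderType d3).

Lemma iso_osuml : iso P Q -> iso (osum P S) (osum Q S).
Proof.
move=> i; have PQ := iso_card i; case/isoP: i => f _ fm.
pose g (u : osum P S) : osum Q S := match u with inl x => inl (f x) | inr y => inr y end.
apply: (@iso_emb _ _ _ _ g); last by rewrite !card_osum PQ.
by move=> [x|x] [y|y]; rewrite !osum_leE //= fm.
Qed.

Lemma iso_osumr : iso P Q -> iso (osum S P) (osum S Q).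
Proof.
move=> i; have PQ := iso_card i; case/isoP: i => f _ fm.
pose g (u : osum S P) : osum S Q := match u with inl x => inl x | inr y => inr (f y) end.
apply: (@iso_emb _ _ _ _ g); last by rewrite !card_osum PQ.
by move=> [x|x] [y|y]; rewrite !osum_leE //= fm.
Qed.

Lemma iso_osumA : iso (osum (osum P Q) S) (osum P (osum Q S)).
Proof.
pose g (u : osum (osum P Q) S) : osum P (osum Q S) :=
  match u with inl (inl x) => inl x | inl (inr y) => inr (inl y) | inr z => inr (inr z) end.
apply: (@iso_emb _ _ _ _ g); last by rewrite !card_osum addnA.
by move=> [[x|x]|x] [[y|y]|y]; rewrite !osum_leE.
Qed.

Lemma iso_osum0 : iso P (osum (antichain 0) P).
Proof.
apply: (@iso_emb _ _ _ _ (fun x => inr x : osum (antichain 0) P)) => //.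
by rewrite card_osum card_ord.
Qed.

Lemma iso_osumr0 : iso (osum P (antichain 0)) (osum (antichain 0) P).
Proof.
pose g (u : osum P (antichain 0)) : osum (antichain 0) P :=
  match u with inl x => inr x | inr y => inl y end.
apply: (@iso_emb _ _ _ _ g); last by rewrite !card_osum addnC.
by move=> [x|[]//] [y|[]//]; rewrite !osum_leE.
Qed.
End IsoOsum.

Lemma iso_refl d (P : finPOrderType d) : iso P P.
Proof. exact: (@iso_emb _ _ _ _ id). Qed.

Lemma layered_osum d (P : finPOrderType d) m :
  layered P -> layered (osum P (antichain m)).
Proof.
case=> s is_; exists (rcons s m); apply: iso_trans (iso_osuml _ is_) _.
elim: s {is_} => [|a s IH] /=; first exact: iso_sym (iso_osumr0 _).
exact: iso_trans (iso_osumA _ _ _) (iso_osumr _ IH).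
Qed.

Lemma layered_antichain m : layered (antichain m).
Proof. by exists [:: m]; apply: iso_trans (iso_osum0 _) (iso_sym (iso_osumr0 _)). Qed.

(** Order dimension at most two, given by coordinates; [dim2_perm] identifies such posets with the
    $P_r$. In this form ordinal sums only require a shift. *)
Definition dim2 {d} (P : finPOrderType d) : Prop := exists f g : P -> nat,
  [/\ injective f, injective g & forall x y, (x <= y)%O = (f x <= f y) && (g x <= g y)].

Lemma dim2_iso d d' (P : finPOrderType d) (P' : finPOrderType d') :
  iso P P' -> dim2 P' -> dim2 P.
Proof.
case/isoP=> h hb hm [f [g [fi gi fg]]]; exists (f \o h), (g \o h); split.
- exact: inj_comp fi (bij_inj hb).
- exact: inj_comp gi (bij_inj hb).
- by move=> x y; rewrite -hm fg.
Qed.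

Lemma dim2_antichain m : dim2 (antichain m).
Proof.
exists val, (fun i : 'I_m => m - i); split; first exact: val_inj.
- by move=> i j; have := ltn_ord i; have := ltn_ord j => ? ? ?; apply: ord_inj; lia.
move=> x y; rewrite antichain_leE; have := ltn_ord x; have := ltn_ord y => ? ?.
by rewrite -(inj_eq val_inj) /= ; apply/eqP/andP => [->//|[]]; lia.
Qed.

Lemma dim2_osum d d' (P : finPOrderType d) (Q : finPOrderType d') :
  dim2 P -> dim2 Q -> dim2 (osum P Q).
Proof.
case=> f [g [fi gi fg]] [f' [g' [fi' gi' fg']]].
pose N := (\max_(x : P) maxn (f x) (g x)).+1.
have fN x : f x < N /\ g x < N.
  have : maxn (f x) (g x) < N by rewrite ltnS (leq_bigmax x).
  lia.
pose F (h : P -> nat) (h' : Q -> nat) (u : osum P Q) :=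
  match u with inl x => h x | inr y => N + h' y end.
exists (F f f'), (F g g'); split.
- move=> [x|x] [y|y] /=; [by move/fi->| | |by move/addnI/fi'->].
    by have [? _] := fN x; lia.
  by have [? _] := fN y; lia.
- move=> [x|x] [y|y] /=; [by move/gi->| | |by move/addnI/gi'->].
    by have [_ ?] := fN x; lia.
  by have [_ ?] := fN y; lia.
move=> [x|x] [y|y]; rewrite osum_leE /= ?leq_add2l ?fg ?fg' //.
  by have := fN x; lia.
by have := fN y; lia.
Qed.

Lemma layered_dim2 d (P : finPOrderType d) : layered P -> dim2 P.
Proof.
case=> s /dim2_iso; apply; elim: s => [|m s IH]; first exact: dim2_antichain.
by apply: dim2_osum => //; apply: dim2_antichain.
Qed.

Section Rank.
Variables (T : finType) (h : T -> nat).
Hypothesis hi : injective h.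

Definition rank x := #|[set y | h y < h x]|.

Lemma rank_lt x : rank x < #|T|.
Proof.
rewrite -cardsT; apply: proper_card; apply/properP; split; first exact: subsetT.
by exists x; rewrite !inE ?ltnn.
Qed.

Lemma rank_mono x y : (rank x <= rank y) = (h x <= h y).
Proof.
apply/idP/idP => [|xy]; last first.
  by apply/subset_leq_card/subsetP => z; rewrite !inE => /leq_trans; apply.
rewrite leqNgt [h x <= _]leqNgt; apply: contra => yx; apply: proper_card; apply/properP; split.
  by apply/subsetP => z; rewrite !inE => /ltn_trans; apply.
by exists y; rewrite !inE ?ltnn.
Qed.

Lemma rank_inj : injective rank.
Proof. by move=> x y xy; apply/hi/eqP; rewrite eqn_leq -!rank_mono xy leqnn. Qed.
End Rank.

(** Ranks under [f] serve as positions and ranks under [g] as values, so $r=G\circ F^{-1}$. *)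
Lemma dim2_perm d (P : finPOrderType d) k : #|P| = k -> dim2 P ->
  exists r : 'S_k, iso P (perm_poset r).
Proof.
move=> <- [f [g [fi gi fg]]].
pose F x := Ordinal (rank_lt f x); pose G x := Ordinal (rank_lt g x).
have Fi : injective F by move=> x y [/(rank_inj fi)].
have Gi : injective G by move=> x y [/(rank_inj gi)].
have [F' FK F'K] : bijective F by apply: inj_card_bij => //; rewrite card_ord.
have ri : injective (G \o F') by apply: inj_comp Gi (can_inj F'K).
exists (perm ri); apply: (@iso_emb _ _ _ _ (G : P -> perm_poset (perm ri))).
  move=> x y.
  have rF z : ((perm ri)^-1)%g (G z) = F z
    by have -> : G z = perm ri (F z) by [rewrite permE /= FK]; rewrite permK.
  rewrite -[LHS]/((((perm ri)^-1)%g (G x) <= ((perm ri)^-1)%g (G y)) && (G x <= G y)).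
  by rewrite !rF /= !rank_mono fg.
by rewrite card_ord.
Qed.

(** * Copy numbers of explicit posets *)

Lemma copies_antichain l m : 0 < l -> copies (fanposet l) (antichain m) = 0.
Proof.
move=> l0; rewrite copies_nfans // /nfans big1 // => z _.
rewrite fans_maximal ?cards0 //; apply/maximalP => v.
by rewrite lt_neqAle antichain_leE andNb.
Qed.

(** A form that can be evaluated: each two-element antichain is listed once, by the condition
    $i<j$. *)
Lemma nfans_pairs n (e : rel 'I_n) : nfans e setT 2 =
  \sum_(z < n) \sum_(i < n) \sum_(j < n)
     [&& i < j, e z i, e z j, ~~ e i i, ~~ e i j, ~~ e j i & ~~ e j j].
Proof.
rewrite /nfans (eq_bigl xpredT) => [|z]; last by rewrite in_setT.
apply: eq_bigr => z _.
pose D := [set p : 'I_n * 'I_n | (p.1 < p.2) && fan e z [set p.1; p.2]].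
have fanE i j : fan e z [set i; j] = [&& e z i, e z j, ~~ e i i, ~~ e i j, ~~ e j i & ~~ e j j].
  apply/fanP/idP => [[h1 h2]|/and5P[zi zj ii ij /andP[ji jj]]].
    by rewrite !h1 ?h2 // !inE eqxx ?orbT.
  split=> [s|u v]; rewrite !inE; first by case/orP=> /eqP->.
  by move=> /orP[]/eqP-> /orP[]/eqP->; apply: negbTE.
transitivity #|D|; last first.
  rewrite -sum1_card big_mkcond /= pair_big /=; apply: eq_bigr => p _.
  by rewrite inE fanE; case: (_ && _).
pose F (p : 'I_n * 'I_n) := [set p.1; p.2].
have -> : fans e setT 2 z = F @: D.
  apply/setP => S; apply/idP/imsetP => [|[p + ->]]; rewrite !inE subsetT /=.
    move=> /andP[/cards2P[i [j [ij ->]]] zS]; have [lij|lji] := ltnP i j.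
      by exists (i, j); rewrite // inE lij.
    exists (j, i); rewrite /F /= 1?setUC // inE setUC zS andbT /=.
    by rewrite ltn_neqAle lji andbT eq_sym.
  move=> /andP[pq ->]; rewrite cards2 (_ : p.1 != p.2) //.
  by apply: contraTneq pq => ->; rewrite ltnn.
apply: card_in_imset => -[i j] [i' j']; rewrite !inE /F /= => /andP[ij _] /andP[ij' _] /setP E.
have := E i; have := E j; have := E i'; have := E j'; rewrite !inE !eqxx !orbT.
case: (eqVneq i i') => [<-|_]; case: (eqVneq j j') => [<-|_] //=.
all: rewrite ?orbF.
- by move=> _ _ /esym/eqP ji; move: ij; rewrite ji ltnn.
- by move=> _ _ _ /esym/eqP ji; move: ij; rewrite ji ltnn.
by move=> /eqP ji /eqP e'; move: ij'; rewrite ji e' ltnNge (ltnW ij).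
Qed.

(* The poset of the permutation 15342, that is [A_1 (+) (C_2 + A_1 + A_1)]. *)
Definition coord5 : nat -> nat := nth 0 [:: 0; 4; 2; 3; 1].

Definition rel5 : rel 'I_5 := fun i j => (i < j) && (coord5 i < coord5 j).

Lemma strict_rel5 : strict rel5.
Proof.
split=> [i|j i k /andP[ij ij'] /andP[jk jk']]; first by rewrite /rel5 ltnn.
by rewrite /rel5 (ltn_trans ij jk) (ltn_trans ij' jk').
Qed.

(** Of the six pairs above the minimum exactly one is comparable. Sums over [nat] intervals evaluate
    after [unlock]. *)
Lemma nfans_rel5 : nfans rel5 setT 2 = 5.
Proof.
pose r (i j : nat) := (i < j) && (coord5 i < coord5 j).
rewrite nfans_pairs; transitivity (\sum_(0 <= z < 5) \sum_(0 <= i < 5) \sum_(0 <= j < 5)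
  [&& i < j, r z i, r z j, ~~ r i i, ~~ r i j, ~~ r j i & ~~ r j j]); last by rewrite unlock.
by do 3 (rewrite big_mkord; apply: eq_bigr => ? _).
Qed.

(** * Posets with one copy less than the maximum *)

(** [maxcopies_rec] peels off top antichains until the maximum is zero, where an antichain is
    optimal. *)
Lemma layered_opt l n : 0 < l -> exists d (Q : finPOrderType d),
  [/\ #|Q| = n, copies (fanposet l) Q = Mx l n & layered Q].
Proof.
move=> l0; have [N] := ubnP n; elim: N n => // N IH n nN.
case: (posnP (Mx l n)) => [->|/(maxcopies_rec l0)[k [m [nE lm k0 ->]]]].
  exists poset_display, (antichain n); split; first exact: card_ord.
    exact: copies_antichain.
  exact: layered_antichain.
have [|d [Q [Qk cQ lQ]]] := IH k; first by lia.
exists poset_display, (osum Q (antichain m)); split.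
- by rewrite card_osum Qk card_ord.
- by rewrite copies_osum // cQ Qk.
- exact: layered_osum.
Qed.

(** The desired conclusion with a poset [X] of dimension at most two in place of $P_r$, which suits
    the induction. *)
Definition near_opt_form l n : Prop := exists d (Q : finPOrderType d),
  [/\ #|Q| = n, (copies (fanposet l) Q).+1 = Mx l n, 2 < l -> layered Q,
      l = 2 -> exists d1 (Q1 : finPOrderType d1) d2 (Q2 : finPOrderType d2),
                 [/\ iso Q (osum Q1 Q2), #|Q1| <= 5 & layered Q2]
    & exists m d' (X : finPOrderType d'),
        [/\ dim2 X, iso Q (osum X (antichain m)) & ~ (l = 2 /\ n = 5) -> 0 < m]].

Lemma near_opt_layered l k m d (Q : finPOrderType d) :
  #|Q| = k -> 0 < m -> (copies (fanposet l) (osum Q (antichain m))).+1 = Mx l (k + m) ->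
  layered Q -> near_opt_form l (k + m).
Proof.
move=> Qk m0 cQ lQ; have lQm := layered_osum m lQ.
exists poset_display, (osum Q (antichain m)); split=> //.
- by rewrite card_osum Qk card_ord.
- move=> _; exists poset_display, (antichain 0), poset_display, (osum Q (antichain m)).
  by split=> //; [exact: iso_osum0|rewrite card_ord].
- by exists m, d, Q; split=> //; [exact: layered_dim2|exact: iso_refl].
Qed.

(** All of [Q] becomes the new [X], so the top antichain is nonempty even if that of [Q] was
    empty. *)
Lemma near_opt_add l k m : 0 < l -> 0 < m -> Mx l (k + m) = Mx l k + k * 'C(m, l) ->
  near_opt_form l k -> near_opt_form l (k + m).
Proof.
move=> l0 m0 Mkm [d [Q [Qk cQ lQ sQ [m' [d' [X [dX iQ _]]]]]]].
exists poset_display, (osum Q (antichain m)); split.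
- by rewrite card_osum Qk card_ord.
- by rewrite copies_osum // Mkm Qk -cQ.
- by move=> /lQ; exact: layered_osum.
- move=> /sQ [d1 [Q1 [d2 [Q2 [iQ' c1 lQ2]]]]].
  exists d1, Q1, poset_display, (osum Q2 (antichain m)); split=> //.
    exact: iso_trans (iso_osuml _ iQ') (iso_osumA _ _ _).
  exact: layered_osum.
- exists m, d, Q; split=> //; last exact: iso_refl.
  by apply: dim2_iso iQ _; apply: dim2_osum => //; apply: dim2_antichain.
Qed.

Lemma maxcopies_succ l : 1 < l -> Mx l l.+1 <= 1.
Proof.
move=> l2; have l0 := ltnW l2; case: (posnP (Mx l l.+1)) => [->//|].
case/(maxcopies_rec l0)=> k [m [nE lm k0 ->]].
have -> : k = 1 by lia.
have -> : m = l by lia.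
by rewrite binn maxcopies_small.
Qed.

Lemma maxcopies_2_4 : Mx 2 4 = 3.
Proof.
apply/eqP; rewrite eqn_leq; apply/andP; split; last first.
  by have := maxcopies_add 1 3 (isT : 0 < 2); apply: leq_trans; rewrite leq_addl.
case: (posnP (Mx 2 4)) => [->//|/(maxcopies_rec (isT : 0 < 2))[k [m [nE lm k0 ->]]]].
have [[-> ->]|[-> ->]] : (k = 1 /\ m = 3) \/ (k = 2 /\ m = 2) by lia.
  by rewrite maxcopies_small.
by rewrite maxcopies_small.
Qed.

Lemma maxcopies_2_5 : Mx 2 5 = 6.
Proof.
apply/eqP; rewrite eqn_leq; apply/andP; split; last first.
  by have := maxcopies_add 1 4 (isT : 0 < 2); apply: leq_trans; rewrite leq_addl.
case: (posnP (Mx 2 5)) => [->//|/(maxcopies_rec (isT : 0 < 2))[k [m [nE lm k0 ->]]]].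
have [[-> ->]|[[-> ->]|[-> ->]]] :
    (k = 1 /\ m = 4) \/ (k = 2 /\ m = 3) \/ (k = 3 /\ m = 2) by lia.
- by rewrite maxcopies_small.
- by rewrite maxcopies_small.
by have := @maxcopies_succ 2 isT; rewrite binn; lia.
Qed.

Lemma near_opt_5 : near_opt_form 2 5.
Proof.
pose Q : finPOrderType poset_display := relposet strict_rel5.
have Q5 : #|Q| = 5 by rewrite card_relposet card_ord.
exists poset_display, Q; split=> //.
- by rewrite copies_relposet // nfans_rel5 maxcopies_2_5.
- move=> _; exists poset_display, Q, poset_display, (antichain 0); split.
  + exact: iso_trans (iso_osum0 _) (iso_sym (iso_osumr0 _)).
  + by rewrite Q5.
  + exact: layered_antichain.
exists 0, poset_display, Q; split; last by case.
  exists (val : 'I_5 -> nat), (coord5 \o (val : 'I_5 -> nat)); split.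
  - exact: val_inj.
  - by move=> [[|[|[|[|[|x]]]]] // ?] [[|[|[|[|[|y]]]]] // ?] // _; apply: val_inj.
  - move=> x y; rewrite -[LHS]/((x == y) || rel5 x y).
    by case: x y => [[|[|[|[|[|x]]]]] // ?] [[|[|[|[|[|y]]]]] // ?].
exact: iso_trans (iso_osum0 _) (iso_sym (iso_osumr0 _)).
Qed.

Lemma near_opt l (l2 : 1 < l) (T : finType) (e : rel T) :
  strict e -> (nfans e setT l).+1 = Mx l #|T| -> near_opt_form l #|T|.
Proof.
have l0 := ltnW l2; have [N] := ubnP #|T|; elim: N T e => // N IH T e nN se eM.
(* Here $M_n=1$, and an antichain has no copies. *)
have [nl|nl] := eqVneq #|T| l.+1.
  rewrite nl in eM *; rewrite -[l.+1]/(0 + l.+1).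
  apply: (@near_opt_layered _ _ _ _ (antichain 0)) => //; first exact: card_ord.
    have := maxcopies_succ l2; have : 0 < Mx l l.+1 by rewrite -eM.
    by rewrite copies_osum // copies_antichain // card_ord !add0n mul0n; lia.
  exact: layered_antichain.
case: (boolP ((l == 2) && (#|T| <= 5))) => [/andP[/eqP le2 n5]|n5].
  rewrite {}le2 {l l2 l0 IH} in eM nl *.
  have n2 : 2 < #|T| by rewrite ltnNge; apply/negP => n2; rewrite maxcopies_small in eM.
  (* Four elements: $\mathcal{A}_2\oplus\mathcal{A}_2$ has two copies and the maximum is three. *)
  have [n4|n5'] : #|T| = 4 \/ #|T| = 5 by move: nl => /eqP; lia.
    rewrite n4 -[4]/(2 + 2); apply: (@near_opt_layered _ _ _ _ (antichain 2)) => //.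
    - exact: card_ord.
    - by rewrite copies_osum // copies_antichain // card_ord maxcopies_2_4.
    - exact: layered_antichain.
  by rewrite n5'; apply: near_opt_5.
have [||e' [se' eM' te']] := near_opt_top l2 se eM.
- exact/eqP.
- by case=> /eqP le2 n5'; rewrite le2 n5' in n5.
set W := maxima e' in te'.
have M0 : 0 < Mx l #|T| by rewrite -eM.
have T0 : 0 < #|T| by case: (posnP #|T|) => // T0; rewrite T0 maxcopies0 in M0.
have W0 : 0 < #|W| by apply: maxima_gt0.
have nT : #|T| = #|~: W| + #|W| by rewrite addnC cardsC.
have := nfans_top se' te' l0; have := nfans_le_sub (~: W) se' l0.
have := maxcopies_add #|~: W| #|W| l0; rewrite -nT -eM' => h1 h2 h3.
(* The single missing copy is lost either by the choice of sizes, and then a layered optimal poset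
   can replace the lower part, or inside the lower part, to which induction applies. *)
rewrite nT; have [eK|eK] : nfans e' (~: W) l = Mx l #|~: W| \/
                          (nfans e' (~: W) l).+1 = Mx l #|~: W| by lia.
  have [d [Q [Qk cQ lQ]]] := layered_opt #|~: W| l0.
  by apply: (near_opt_layered Qk W0 _ lQ); rewrite copies_osum // cQ Qk -nT -eM' h3 eK.
apply: near_opt_add => //; first by rewrite -nT -eM' h3 -eK.
have sC : #|{: {x | x \in ~: W}}| = #|~: W| := card_sig _.
rewrite -sC; apply: (IH _ (relpre val e')); rewrite ?nfans_sub ?sC //.
  by move: nN W0; rewrite nT; lia.
exact: strict_pre.
Qed.

Theorem theorem7p10 (l n : nat) (l_ge2 : 2 <= l) :
  let Ql := osum (antichain 1) (antichain l) in
  let M := maxcopies n Ql in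
  (exists d (P : finPOrderType d), #|P| = n /\ (copies Ql P).+1 = M) ->
  exists d (Q : finPOrderType d),
    [/\ #|Q| = n,
        (copies Ql Q).+1 = M,
        2 < l -> layered Q,
        l = 2 -> exists d1 (Q1 : finPOrderType d1) d2 (Q2 : finPOrderType d2),
                   [/\ iso Q (osum Q1 Q2), #|Q1| <= 5 & layered Q2]
      & exists (m : nat) (r : 'S_(n - m)),
          [/\ m <= n,
              iso Q (osum (perm_poset r) (antichain m))
            & ~ (l = 2 /\ n = 5) -> 0 < m]].
Proof.
move=> Ql M [d [P [Pn cP]]]; rewrite -{}Pn in M cP *.
rewrite copies_nfans in cP; last exact: ltnW.
have [d0 [Q [Qn cQ lQ sQ [m [d' [X [dX iX m0]]]]]]] := near_opt l_ge2 (strict_lt P) cP.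
have nX : #|X| + m = #|P| by rewrite -Qn (iso_card iX) card_osum card_ord.
have [|r ir] := @dim2_perm _ X (#|P| - m) _ dX; first by rewrite -nX addnK.
exists d0, Q; split=> //; exists m, r; split=> //; first by rewrite -nX leq_addl.
exact: iso_trans iX (iso_osuml _ ir).
Qed.
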